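(* Let $G=(V,E)$ be an oriented interval catch digraph such that its underlying undirected graph $U(G)$ is chordal. Then $G$ is a proper oriented interval catch digraph if and only if it does not contain any of the following digraphs $D_3,\ldots,D_9$, each on the vertex set $\{v_1,v_2,v_3,v_4\}$, as an induced subdigraph: - $D_3$: arcs $v_2\to v_1$, $v_4\to v_1$, $v_3\to v_2$, $v_4\to v_3$, $v_3\to v_1$; - $D_4$: arcs $v_2\to v_3$, $v_4\to v_2$, $v_4\to v_3$, and the edge $v_1v_2$ with either direction; - $D_5$: arcs $v_2\to v_1$, $v_2\to v_3$, and the edge $v_2v_4$ with either direction; - $D_6$: arcs $v_1\to v_2$, $v_1\to v_4$, $v_1\to v_3$, $v_3\to v_2$, $v_3\to v_4$; - $D_7$: arcs $v_3\to v_2$, $v_3\to v_4$, $v_2\to v_1$, $v_4\to v_1$, $v_3\to v_1$; - $D_8$: arcs $v_2\to v_3$, $v_2\to v_1$, $v_1\to v_3$, $v_4\to v_3$, $v_4\to v_1$; - $D_9$: arcs $v_3\to v_2$, $v_2\to v_1$, $v_3\to v_4$, $v_1\to v_4$, $v_3\to v_1$.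
   Context: Digraphs are finite and simple (no loops, no multiple arcs). The underlying graph $U(G)$ of $G=(V,E)$ is the undirected graph on $V$ in which $u,v$ are adjacent if and only if $uv\in E$ or $vu\in E$. A graph is chordal if it has no induced cycle of length at least $4$. Containing a digraph as an induced subdigraph is meant up to isomorphism; when an edge may have either direction, both resulting digraphs are forbidden. A digraph $G=(V,E)$ is an interval catch digraph (ICD) if one can assign to each $u\in V$ a closed bounded interval $I_u$ of the real line and a point $p_u\in I_u$ such that for $u,v\in V$: $uv\in E$ if and only if $u\neq v$ and $p_v\in I_u$. An oriented ICD is an ICD with no pair $u,v$ such that both $uv\in E$ and $vu\in E$. A proper oriented ICD is an oriented ICD having such a representation in which no interval properly contains another. *)

(* Defs.v *)
From mathcomp Require Import all_boot all_order all_algebra.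
From mathcomp Require Import classical_sets reals.
Set Implicit Arguments.
Unset Strict Implicit.
Unset Printing Implicit Defensive.
Import Order.TTheory GRing.Theory Num.Theory.

(* A finite simple digraph on V is an irreflexive relation [G : rel V], with
   [G u v] meaning that uv is an arc; an undirected graph is a symmetric one. *)

Definition underlying (V : finType) (G : rel V) : rel V :=
  [rel u v | G u v || G v u].

Definition contains_induced (W V : finType) (H : rel W) (G : rel V) : Prop :=
  exists f : W -> V, injective f /\ forall x y : W, G (f x) (f y) = H x y.

(* [ordS] is the successor modulo n. *)
Definition cycle_graph (n : nat) : rel 'I_n :=
  [rel i j | (ordS i == j) || (ordS j == i)].

Definition chordal (V : finType) (U : rel V) : Prop :=
  forall n : nat, 4 <= n -> ~ contains_induced (@cycle_graph n) U.

Definition oriented (V : finType) (G : rel V) : Prop :=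
  forall u v : V, ~~ (G u v && G v u).

Section IntervalCatchDigraphs.
Local Open Scope ring_scope.
Variables (R : realType) (V : finType).
Implicit Types (G : rel V) (l r p : V -> R).

(* u is assigned the interval [l u, r u] and the point p u. *)
Definition ICD_representation G l r p : Prop :=
  (forall u : V, p u \in `[l u, r u]) /\
  (forall u v : V, G u v = (u != v) && (p v \in `[l u, r u])).

Definition proper_intervals l r : Prop :=
  forall u v : V, ~ (`[l u, r u] `<` `[l v, r v])%classic.

Definition is_ICD G : Prop := exists l r p, ICD_representation G l r p.

Definition is_oriented_ICD G : Prop := is_ICD G /\ oriented G.

Definition is_proper_oriented_ICD G : Prop :=
  is_oriented_ICD G /\
  exists l r p, ICD_representation G l r p /\ proper_intervals l r.

End IntervalCatchDigraphs.

(* The digraph on {v_1, v_2, v_3, v_4} given by a list of arcs; the pair (i, j)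
   stands for v_i -> v_j, and v_i is the ordinal of value i - 1. *)
Definition digraph4 (arcs : seq (nat * nat)) : rel 'I_4 :=
  [rel i j : 'I_4 | (i.+1, j.+1) \in arcs].

Definition D3 : seq (nat * nat) := [:: (2, 1); (4, 1); (3, 2); (4, 3); (3, 1)].

(* D4 and D5 have an edge of free direction, hence two versions each. *)
Definition D4 : seq (nat * nat) := [:: (2, 3); (4, 2); (4, 3); (1, 2)].
Definition D4' : seq (nat * nat) := [:: (2, 3); (4, 2); (4, 3); (2, 1)].

Definition D5 : seq (nat * nat) := [:: (2, 1); (2, 3); (2, 4)].
Definition D5' : seq (nat * nat) := [:: (2, 1); (2, 3); (4, 2)].

Definition D6 : seq (nat * nat) := [:: (1, 2); (1, 4); (1, 3); (3, 2); (3, 4)].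
Definition D7 : seq (nat * nat) := [:: (3, 2); (3, 4); (2, 1); (4, 1); (3, 1)].
Definition D8 : seq (nat * nat) := [:: (2, 3); (2, 1); (1, 3); (4, 3); (4, 1)].
Definition D9 : seq (nat * nat) := [:: (3, 2); (2, 1); (3, 4); (1, 4); (3, 1)].

Definition forbidden : seq (seq (nat * nat)) :=
  [:: D3; D4; D4'; D5; D5'; D6; D7; D8; D9].

(* Main.v *)
(* Say that a linear order of V is coherent if every arc from x to z, with y
   strictly between x and z, comes with arcs from x to y and from y to z. A
   proper oriented representation orders its points coherently, and any coherent
   order gives a proper representation; so the forbidden digraphs, which have no
   coherent order, cannot occur.

   Conversely, the points of an ICD order V so that the closed
   out-neighbourhood of every vertex is consecutive; hence no triangle is
   cyclic. If b -> a and b -> c with b < a < c and a, c nonadjacent, the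
   forbidden digraphs force b to be the first vertex of its component, and the
   nonneighbours of c between b and c to have no neighbours besides b and each
   other: moving b past them keeps out-neighbourhoods consecutive and decreases
   the number of pairs of out-neighbours lying on the same side of a vertex.
   When this stops, the order has the umbrella property for U(G): if xz is an
   edge and x < y < z, then so are xy and yz. If the middle vertex of the
   transitive triangle on x < y < z is not y, then it and y are true twins of
   U(G). It remains to sort each class of true twins along its arcs, in the
   direction imposed by the arcs that join it to other vertices. *)
Require Import Defs.
From mathcomp Require Import all_boot all_order all_algebra.
From mathcomp Require Import reals.
From mathcomp Require Import zify.
Set Implicit Arguments.
Unset Strict Implicit.
Unset Printing Implicit Defensive.
Import Order.TTheory GRing.Theory Num.Theory.

(** * Linear orders and their compatibility with arcs and edges *)

Section Orders.
Variables (V : finType) (G : rel V).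
Local Notation U := (underlying G).
Implicit Type lt : rel V.

Definition strict_total lt : Prop :=
  [/\ irreflexive lt, transitive lt & forall u v, u != v -> lt u v || lt v u].

(** Equivalently, for a strict total order, closed out-neighbourhoods are consecutive. *)
Definition catch_order lt : Prop :=
  forall x y z, lt x y -> lt y z -> (G x z -> G x y) /\ (G z x -> G z y).

(** The kind of vertex order that characterizes proper interval graphs. *)
Definition umbrella lt : Prop :=
  forall x y z, lt x y -> lt y z -> U x z -> U x y /\ U y z.

(** Adds to [catch_order] that closed in-neighbourhoods are consecutive too. *)
Definition coherent lt : Prop := forall x y z, lt x y -> lt y z ->
  (G x z -> G x y /\ G y z) /\ (G z x -> G z y /\ G y x).

Definition converse lt : rel V := [rel x y | lt y x].

Lemma converse_strict_total lt : strict_total lt -> strict_total (converse lt).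
Proof.
case=> irr tr tot; split=> [x|y x z|u v]; rewrite /converse /=.
  exact: irr.
  by move=> xy yz; apply: tr yz xy.
by move=> /tot /orP [] ->; rewrite ?orbT.
Qed.

Lemma converse_catch_order lt : catch_order lt -> catch_order (converse lt).
Proof. by move=> c x y z xy yz; case: (c z y x yz xy). Qed.

Lemma underlyingE u v : U u v = G u v || G v u.
Proof. by []. Qed.

Lemma underlyingC u v : U u v = U v u.
Proof. by rewrite !underlyingE orbC. Qed.

Lemma converse_umbrella lt : umbrella lt -> umbrella (converse lt).
Proof.
by move=> c x y z xy yz; rewrite underlyingC => /(c _ _ _ yz xy) [];
   rewrite !(underlyingC y).
Qed.

Section StrictTotal.
Variable lt : rel V.
Hypothesis stlt : strict_total lt.

Lemma st_irr x : lt x x = false.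
Proof. by case: stlt. Qed.

Lemma st_trans y x z : lt x y -> lt y z -> lt x z.
Proof. by case: stlt => _ + _; apply. Qed.

Lemma st_asym x y : lt x y -> lt y x = false.
Proof. by move=> xy; apply/negP => /(st_trans xy); rewrite st_irr. Qed.

Lemma st_neq x y : lt x y -> x != y.
Proof. by apply: contraTneq => ->; rewrite st_irr. Qed.

Lemma stP x y : [\/ lt x y, x = y | lt y x].
Proof.
have [->|] := eqVneq x y; first by constructor 2.
by case: stlt => _ _ /[apply] /orP [|]; [constructor 1|constructor 3].
Qed.

Lemma st_neqF x y : x != y -> lt y x = ~~ lt x y.
Proof.
move=> xy; case: (stP x y) => [h|/eqP|h]; first by rewrite h (st_asym h).
  by rewrite (negPf xy).
by rewrite h (st_asym h).
Qed.

End StrictTotal.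

End Orders.

(** * Representations and coherent orders *)

Section Representations.
Local Open Scope ring_scope.
Variables (R : realType) (V : finType) (G : rel V).
Implicit Types (lt : rel V) (l r p : V -> R).

(** Two vertices sharing a point would be joined by arcs in both directions. *)
Lemma oriented_rep_inj l r p :
  oriented G -> ICD_representation G l r p -> injective p.
Proof.
move=> oG [pin GE] u v puv; apply/eqP; apply: contraT => uv.
have := oG u v; rewrite !GE uv eq_sym uv /= -puv pin.
by rewrite puv pin.
Qed.

Lemma oriented_ICD_catch_order :
  is_oriented_ICD R G -> exists2 lt, strict_total lt & catch_order G lt.
Proof.
move=> [[l [r [p rep]]] oG]; have pI := oriented_rep_inj oG rep.
case: rep => pin GE; exists [rel x y | p x < p y].
  split=> [x|y x z|u v uv] /=; first exact: ltxx.
    exact: lt_trans.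
  by rewrite -neq_lt; apply: contra_neq uv => /pI.
move=> x y z /= xy yz; rewrite !GE.
have := pin x; have := pin z; rewrite !in_itv /= => /andP [lz rz] /andP [lx rx].
have -> : x != y by apply: contraTneq xy => ->; rewrite ltxx.
have -> : z != y by apply: contraTneq yz => ->; rewrite ltxx.
split=> /andP [_ /andP [l1 r1]].
  by rewrite (le_trans lx (ltW xy)) (le_trans (ltW yz) r1).
by rewrite (le_trans l1 (ltW xy)) (le_trans (ltW yz) rz).
Qed.

Lemma proper_oriented_ICD_coherent :
  is_proper_oriented_ICD R G -> exists2 lt, strict_total lt & coherent G lt.
Proof.
move=> [[_ oG] [l [r [p [rep prop]]]]]; have pI := oriented_rep_inj oG rep.
case: rep => pin GE; exists [rel x y | p x < p y].
  split=> [x|y x z|u v uv] /=; first exact: ltxx.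
    exact: lt_trans.
  by rewrite -neq_lt; apply: contra_neq uv => /pI.
have pinE u : (l u <= p u) && (p u <= r u) by have := pin u; rewrite in_itv.
have comparable u v :
    (l u <= l v) && (r u <= r v) || (l v <= l u) && (r v <= r u).
  case: (leP (l u) (l v)) => luv; case: (leP (r u) (r v)) => ruv //=.
  - case: (prop v u); split=> [x /=|/(_ (r u)) /=]; rewrite !in_itv /=.
      move=> /andP [lx rx].
      by rewrite (le_trans luv lx) (le_trans rx (ltW ruv)).
    have /andP [h1 h2] := pinE u; rewrite lexx (le_trans h1 h2) => /(_ isT).
    by rewrite [r u <= r v]leNgt ruv andbF.
  - case: (prop u v); split=> [x /=|/(_ (l v)) /=]; rewrite !in_itv /=.
      move=> /andP [lx rx].
      by rewrite (le_trans (ltW luv) lx) (le_trans rx ruv).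
    have /andP [h1 h2] := pinE v; rewrite lexx (le_trans h1 h2) => /(_ isT).
    by rewrite [l u <= l v]leNgt luv.
  by rewrite (ltW luv) (ltW ruv).
(* If the ends were ordered against the points, each point would lie in the other interval, giving
   both arcs. *)
have mono u v : p u < p v -> (l u <= l v) && (r u <= r v).
  move=> uv; case/orP: (comparable u v) => // /andP [lvu rvu].
  have /andP [h1 h2] := pinE v; have /andP [h3 h4] := pinE u.
  have nuv : u != v by apply: contraTneq uv => ->; rewrite ltxx.
  have := oG u v; rewrite !GE nuv (eq_sym v) nuv !in_itv /=.
  rewrite (le_trans h2 rvu) (le_trans h3 (ltW uv)).
  by rewrite (le_trans lvu h3) (le_trans (ltW uv) h2).
move=> x y z /= xy yz; rewrite !GE !in_itv /=.
have /andP [lx rx] := pinE x; have /andP [lz rz] := pinE z.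
have /andP [ly ry] := pinE y.
have -> : x != y by apply: contraTneq xy => ->; rewrite ltxx.
have nyz : y != z by apply: contraTneq yz => ->; rewrite ltxx.
rewrite nyz [z == y]eq_sym nyz.
have nyx : y != x by apply: contraTneq xy => ->; rewrite ltxx.
rewrite nyx.
have /andP [lxy rxy] := mono _ _ xy; have /andP [lyz ryz] := mono _ _ yz.
split=> /andP [_ /andP [l1 r1]]; rewrite /=; split; apply/andP; split.
- exact: le_trans lx (ltW xy).
- exact: le_trans (ltW yz) r1.
- exact: le_trans ly (ltW yz).
- exact: le_trans r1 rxy.
- exact: le_trans l1 (ltW xy).
- exact: le_trans (ltW yz) rz.
- exact: le_trans lyz l1.
- exact: le_trans (ltW xy) ry.
Qed.

(* The vertex in position [k] gets the point [n * k.+1]; the two ends of its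
   interval are shifted by [k < n], so that intervals with a common end never
   contain each other properly. *)
Lemma coherent_proper_oriented_ICD lt :
    irreflexive G -> oriented G -> strict_total lt -> coherent G lt ->
  is_proper_oriented_ICD R G.
Proof.
move=> iG oG st coh.
pose pos u := #|[set v | lt v u]|; pose n := #|V|.
have posS u v : lt u v -> (pos u < pos v)%N.
  move=> uv; apply: proper_card; rewrite properE; apply/andP; split.
    by apply/subsetP => w; rewrite !inE => /(st_trans st); apply.
  by apply/subsetPn; exists u; rewrite !inE ?(st_irr st).
have posE u v : (pos u < pos v)%N = lt u v.
  case: (stP st u v) => [h|->|h]; first by rewrite h posS.
    by rewrite ltnn (st_irr st).
  by rewrite (st_asym st h) ltnNge ltnW // posS.
have pos_n u : (pos u < n)%N.
  rewrite /n -cardsT; apply: proper_card; rewrite properE subsetT.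
  by apply/subsetPn; exists u; rewrite !inE ?(st_irr st).
pose N u v := (v == u) || G u v.
have Nu u : N u u by rewrite /N eqxx.
(* First and last positions in the closed out-neighbourhood of [u], which coherence makes
   consecutive ([NE]). *)
pose a u := pos [arg min_(v < u | N u v) pos v].
pose b u := pos [arg max_(v > u | N u v) pos v].
have aP u : exists2 w,
    N u w & a u = pos w /\ forall v, N u v -> (pos w <= pos v)%N.
  by rewrite /a; case: arg_minnP => // w Nw h; exists w.
have bP u : exists2 w,
    N u w & b u = pos w /\ forall v, N u v -> (pos v <= pos w)%N.
  by rewrite /b; case: arg_maxnP => // w Nw h; exists w.
have NE u v : N u v = (a u <= pos v <= b u)%N.
  have [w Nw [aE aM]] := aP u; have [w' Nw' [bE bM]] := bP u.
  apply/idP/idP => [Nv|]; first by rewrite aE bE aM // bM.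
  rewrite aE bE /N => /andP [].
  case: (stP st u v) => [uv _|-> //|vu + _]; rewrite ?eqxx //.
    case: (stP st v w') => [vw _|-> //|/posS];
      last by rewrite ltnNge => /negPf ->.
    have uw := st_trans st uv vw.
    have : G u w' by move: Nw'; rewrite /N eq_sym (negPf (st_neq st uw)).
    by move=> /(proj1 (coh _ _ _ uv vw)) [->]; rewrite orbT.
  case: (stP st w v) => [wv _|<- //|/posS]; last by rewrite ltnNge => /negPf ->.
  have wu := st_trans st wv vu.
  have : G u w by move: Nw; rewrite /N (negPf (st_neq st wu)).
  by move=> /(proj2 (coh _ _ _ wv vu)) [->]; rewrite orbT.
(* If the first member [w'] of [N v] precedes [u], coherence on [w'], [u], [v] turns the arc from
   [v] to [w'] into one from [u] to [w']. *)
have a_mono u v : lt u v -> (a u <= a v)%N.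
  move=> uv; have [w Nw [aE aM]] := aP u; have [w' Nw' [-> _]] := aP v.
  rewrite aE; case: (stP st u w') => [/posS/ltnW|<-|wu].
  - by apply: leq_trans; apply: aM.
  - exact: aM.
  apply: aM; apply/orP; right.
  have nvw := st_neq st (st_trans st wu uv).
  have : G v w' by move: Nw'; rewrite /N (negPf nvw).
  by move=> /(proj2 (coh _ _ _ wu uv)) [].
have b_mono u v : lt u v -> (b u <= b v)%N.
  move=> uv; have [w Nw [-> _]] := bP u; have [w' Nw' [-> bM]] := bP v.
  case: (stP st w v) => [/posS/ltnW/leq_trans|->|vw].
  - by apply; apply: bM.
  - exact: bM.
  apply: bM; apply/orP; right.
  have nuw := st_neq st (st_trans st uv vw).
  have : G u w by move: Nw; rewrite /N eq_sym (negPf nuw).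
  by move=> /(proj1 (coh _ _ _ uv vw)) [].
(* As [pos u < n], the shifts pass no multiple of [n] that matters: [l u <= p v] still means
   [a u <= pos v], and [p v <= r u] means [pos v <= b u]. *)
pose l u := (n * a u + (pos u).+1)%N.
pose r u := (n * (b u).+1 + pos u)%N.
pose p u := (n * (pos u).+1)%N.
have inE' u v : (l u <= p v <= r u)%N = N u v.
  rewrite NE /l /r /p; have := pos_n u.
  move: (a u) (b u) (pos u) (pos v) => a' b' k m kn.
  congr (_ && _); apply/idP/idP; nia.
pose cast (f : V -> nat) := fun u => (f u)%:R : R.
have rep : ICD_representation G (cast l) (cast r) (cast p).
  split=> [u|u v]; first by rewrite in_itv /= !ler_nat inE'.
  rewrite in_itv /= !ler_nat inE' /N eq_sym.
  by case: eqVneq => [->|//] /=; rewrite iG.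
split; first by split=> //; exists (cast l), (cast r), (cast p).
exists (cast l), (cast r), (cast p); split=> // u v [sub nsub].
have lr w : (l w <= r w)%N.
  have := inE' w w; rewrite Nu => /andP [h1 h2]; exact: leq_trans h1 h2.
have := sub (cast l u); have := sub (cast r u); rewrite /= !in_itv /= !ler_nat.
rewrite !leqnn lr /= => /(_ isT) /andP [_ rr] /(_ isT) /andP [ll _].
case: (stP st u v) => [uv|uv|vu].
- have : (l u < l v)%N.
    by rewrite /l -addnS leq_add // ?leq_mul2l ?a_mono ?orbT // ltnS posE.
  by rewrite ltnNge ll.
- by apply: nsub; rewrite uv.
have : (r v < r u)%N.
  by rewrite /r -addnS leq_add // ?leq_mul2l ?ltnS ?b_mono ?orbT // posE.
by rewrite ltnNge rr.
Qed.

End Representations.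

(** * Local structure in the absence of the forbidden digraphs *)

Section ForbiddenFree.
Variables (V : finType) (G : rel V).
Local Notation U := (underlying G).
Hypothesis irrG : irreflexive G.
Hypothesis orG : oriented G.

Lemma arcF u v : G u v -> G v u = false.
Proof. by move=> uv; apply: negbTE; have := orG u v; rewrite uv. Qed.

Lemma arc_neq u v : G u v -> u != v.
Proof. by apply: contraTneq => ->; rewrite irrG. Qed.

Lemma underlying_neq u v : U u v -> u != v.
Proof. by apply: contraTneq => ->; rewrite underlyingE irrG. Qed.

Lemma arcU u v : G u v -> U u v.
Proof. by move=> uv; rewrite underlyingE uv. Qed.

Lemma arcUr u v : G u v -> U v u.
Proof. by move=> uv; rewrite underlyingE uv orbT. Qed.

Lemma nonadjP u v : reflect (G u v = false /\ G v u = false) (~~ U u v).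
Proof.
rewrite underlyingE negb_or; apply: (iffP andP) => -[].
  by do 2!move/negPf->.
by do 2!move->.
Qed.

Lemma digraph4_induced (D : seq (nat * nat)) v1 v2 v3 v4 :
    uniq [:: v1; v2; v3; v4] ->
    (forall i j : 'I_4, G (nth v1 [:: v1; v2; v3; v4] i)
                          (nth v1 [:: v1; v2; v3; v4] j) =
                        ((i.+1, j.+1) \in D)) ->
  contains_induced (digraph4 D) G.
Proof.
move=> uq E; exists (fun i : 'I_4 => nth v1 [:: v1; v2; v3; v4] i).
split=> // i j.
by move=> /eqP; rewrite nth_uniq // => /eqP/val_inj.
Qed.

Hypothesis free :
  forall D, D \in forbidden -> ~ contains_induced (digraph4 D) G.

(** Reduces every later exclusion to naming a digraph and a labelling of four distinct vertices. *)
Lemma forbidden_absurd D v1 v2 v3 v4 :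
    D \in forbidden -> uniq [:: v1; v2; v3; v4] ->
    G v1 v2 = ((1, 2) \in D) -> G v2 v1 = ((2, 1) \in D) ->
    G v1 v3 = ((1, 3) \in D) -> G v3 v1 = ((3, 1) \in D) ->
    G v1 v4 = ((1, 4) \in D) -> G v4 v1 = ((4, 1) \in D) ->
    G v2 v3 = ((2, 3) \in D) -> G v3 v2 = ((3, 2) \in D) ->
    G v2 v4 = ((2, 4) \in D) -> G v4 v2 = ((4, 2) \in D) ->
    G v3 v4 = ((3, 4) \in D) -> G v4 v3 = ((4, 3) \in D) -> False.
Proof.
move=> DF uq; do 12!move=> ?; apply: (free DF); apply: digraph4_induced uq _.
have DD k : (k.+1, k.+1) \in D = false.
  move: DF; rewrite !inE; case: k => [|[|[|[|k]]]];
    by do 8!(case/orP => [/eqP-> //|]); move/eqP->.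
by case=> -[|[|[|[|]]]] // ?; case=> -[|[|[|[|]]]] //= ?; rewrite ?irrG ?DD.
Qed.

(** Discharged at the end by [catch_order_acyclic]. *)
Hypothesis acyc : forall x y z, G x y -> G y z -> G z x = false.

(** The triangle is transitive with middle [m], and the pendant [d] completes [D4] or [D4']. *)
Lemma no_mid_pendant s m t d : G s m -> G m t -> U s t -> U m d ->
  ~~ U s d -> ~~ U t d -> d != s -> d != t -> False.
Proof.
move=> sm mt + md /nonadjP [sd ds] /nonadjP [td dt] nds ndt.
rewrite underlyingE (acyc sm mt) orbF => st.
have uq : uniq [:: d; m; t; s].
  rewrite /= !inE !negb_or nds ndt (arc_neq mt) [t == s]eq_sym (arc_neq st).
  by rewrite [m == s]eq_sym (arc_neq sm) [d == m]eq_sym (underlying_neq md).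
have [[ms tm] ts] := (arcF sm, arcF mt, arcF st).
case/orP: (md) => [h|h]; have h' := arcF h.
  exact: (@forbidden_absurd D4' d m t s).
exact: (@forbidden_absurd D4 d m t s).
Qed.

Lemma no_out_claw v a b d : G v a -> G v b -> U v d ->
  ~~ U a b -> ~~ U a d -> ~~ U b d -> a != b -> a != d -> b != d -> False.
Proof.
move=> va vb vd /nonadjP [ab ba] /nonadjP [ad da] /nonadjP [bd db] nab nad nbd.
have uq : uniq [:: a; v; b; d].
  rewrite /= !inE !negb_or nab nad nbd (arc_neq vb) (underlying_neq vd).
  by rewrite eq_sym (arc_neq va).
have [av bv] := (arcF va, arcF vb).
case/orP: (vd) => [h|h]; have h' := arcF h.
  exact: (@forbidden_absurd D5 a v b d).
exact: (@forbidden_absurd D5' a v b d).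
Qed.

(* This is where the acyclic triangles rule out every induced diamond other than
   [D3] and [D6]-[D9] and the one of the conclusion. *)
Lemma diamond_ends b c a d : U b c -> U a b -> U a c -> U d b -> U d c ->
    ~~ U a d -> a != d ->
  [&& G a b, G a c, G b d & G c d] || [&& G d b, G d c, G b a & G c a].
Proof.
have main : forall b' c' a' d', G b' c' -> U a' b' -> U a' c' -> U d' b' ->
    U d' c' -> ~~ U a' d' -> a' != d' ->
  [&& G a' b', G a' c', G b' d' & G c' d'] ||
  [&& G d' b', G d' c', G b' a' & G c' a'].
  move=> {}b {}c {}a {}d bc ab ac db dc /nonadjP [ad da] nad.
  have ncb := arcF bc.
  have uq p : perm_eq p [:: a; b; c; d] -> uniq p.
    move/perm_uniq->; rewrite /= !inE !negb_or nad (arc_neq bc).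
    rewrite (underlying_neq ab) (underlying_neq ac).
    rewrite [b == d]eq_sym [c == d]eq_sym.
    by rewrite (underlying_neq db) (underlying_neq dc).
  have [uq1 uq2 uq3 uq4] : [/\ uniq [:: b; a; c; d], uniq [:: c; a; b; d],
                               uniq [:: c; d; b; a] & uniq [:: a; b; c; d]].
    split; apply: uq; apply/permP => p /=;
      by move: (p a : nat) (p b : nat) (p c : nat) (p d : nat) => ? ? ? ?; lia.
  (* Relative to [b -> c], an end is source, middle or sink of its triangle; of the nine
     combinations only a source with a sink survives. *)
  have apex w : U w b -> U w c ->
      [\/ G w b /\ G w c, G b w /\ G w c | G b w /\ G c w].
    case/orP=> [wb|bw] /orP [] h.
    - by constructor 1.
    - by have := acyc wb bc; rewrite h.
    - by constructor 2.
    by constructor 3.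
  have [[ab' ac']|[ab' ac']|[ab' ac']] := apex a ab ac;
  have [[db' dc']|[db' dc']|[db' dc']] := apex d db dc;
  have [aF aF'] := (arcF ab', arcF ac'); have [dF dF'] := (arcF db', arcF dc').
  - by case: (@forbidden_absurd D8 b a c d).
  - by case: (@forbidden_absurd D3 c d b a).
  - by rewrite ab' ac' db' dc'.
  - by case: (@forbidden_absurd D3 c a b d).
  - by case: (@forbidden_absurd D7 c a b d).
  - by case: (@forbidden_absurd D9 c a b d).
  - by rewrite db' dc' ab' ac' orbT.
  - by case: (@forbidden_absurd D9 c d b a).
  by case: (@forbidden_absurd D6 b a c d).
move=> /orP [] bc ab ac db dc; first exact: main.
rewrite [X in X || _]andbCA [X in _ || X]andbCA.
rewrite [G b d && _]andbC [G b a && _]andbC.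
exact: main.
Qed.

(** In the diamond on the edge [s d], one of the ends [x], [y] would need an arc into [s]. *)
Lemma no_fork_diamond s x y d : G s x -> G s y -> ~~ U x y -> x != y ->
  U d s -> U d x -> U d y -> False.
Proof.
move=> sx sy nxy nexy ds dx dy; have [sd xd yd] : [/\ U s d, U x d & U y d].
  by split; rewrite underlyingC.
have := diamond_ends sd (arcUr sx) xd (arcUr sy) yd nxy nexy.
by rewrite (arcF sx) (arcF sy).
Qed.

Hypothesis chU : chordal U.

Lemma no_square a b c d : U a b -> U b c -> U c d -> U d a ->
  ~~ U a c -> ~~ U b d -> a != c -> b != d -> False.
Proof.
move=> ab bc cd da ac bd nac nbd; apply: (@chU 4) => //.
have uq : uniq [:: a; b; c; d].
  rewrite /= !inE !negb_or nac nbd (underlying_neq ab) (underlying_neq bc).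
  by rewrite (underlying_neq cd) eq_sym (underlying_neq da).
exists (fun i : 'I_4 => nth a [:: a; b; c; d] i); split=> [i j /eqP|].
  by rewrite nth_uniq // => /eqP/val_inj.
have irrU x : U x x = false by rewrite underlyingE irrG.
have [ca db] : ~~ U c a /\ ~~ U d b by rewrite underlyingC ac underlyingC.
have [ba cb dc ad] : [/\ U b a, U c b, U d c & U a d].
  by split; rewrite underlyingC.
rewrite /cycle_graph => -[[|[|[|[|]]]] // ?]; case=> -[|[|[|[|]]]] //= ?;
  rewrite ?irrU ?(negPf ac) ?(negPf bd) ?(negPf ca) ?(negPf db) ?ab ?bc ?cd ?da;
  by rewrite ?ba ?cb ?dc ?ad.
Qed.

(** * From an ICD order to an umbrella order *)

Section Violation.
Variables (lt : rel V) (b a c : V).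
Hypotheses (stlt : strict_total lt) (catch : catch_order G lt).
Hypotheses (ba : lt b a) (ac : lt a c) (bc : G b c) (nac : ~~ U a c).

(** The vertices [b] is moved past. They immediately follow [b] ([blob_initial]), and edges leave
    them only to [b] ([blob_nbr]). *)
Definition blob : {set V} := [set e | [&& lt b e, lt e c & ~~ U e c]].

Lemma arc_below x y z : lt x y -> lt y z -> G x z -> G x y.
Proof. by move=> xy /(catch xy) []. Qed.

Lemma arc_above x y z : lt x y -> lt y z -> G z x -> G z y.
Proof. by move=> xy /(catch xy) []. Qed.

Lemma blobP e : reflect [/\ lt b e, lt e c & ~~ U e c] (e \in blob).
Proof. by rewrite inE; apply: and3P. Qed.

Lemma mem_blob : a \in blob.
Proof. by apply/blobP. Qed.

Lemma blob_arc e : e \in blob -> G b e.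
Proof. by case/blobP => be ec _; apply: arc_below bc. Qed.

(** If [w] is also adjacent to [b] and [c], the arcs from [b] to [e] and [c] give a fork diamond. If
    [w] is left of [b] and misses [c], then [c] is pendant at the middle [b] of the triangle on [w],
    [b], [e]. If [w] is right of [c] and misses [b], then [b], [e], [w], [c] is an induced
    square. *)
Lemma blob_nbr e w : e \in blob -> U e w -> w = b \/ w \in blob.
Proof.
move=> eB ew; have be := blob_arc eB; case/blobP: eB => lbe lec nec.
have ec := st_neq stlt lec.
have no_e_c : G e c = false by case/nonadjP: nec.
have no_c_e : G c e = false by case/nonadjP: nec.
have eb := arcF be; have bcF := arcF bc.
have no_fork := no_fork_diamond be bc nec ec.
case: (stP stlt w b) => [wb|->|bw]; [|by left|].
- case/orP: (ew) => [h|we]; first by rewrite (arc_above wb lbe h) in eb.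
  have wb' := arc_below wb lbe we.
  case: (boolP (U w c)) => [/orP [wc|cw]|nwc].
  + by case: (no_fork w); [apply: arcU|apply: arcU|apply: arcU].
  + by rewrite (arc_above wb (st_trans stlt lbe lec) cw) in bcF.
  case: (no_mid_pendant wb' be (arcU we) (arcU bc) nwc nec).
    by rewrite eq_sym (st_neq stlt (st_trans stlt wb (st_trans stlt lbe lec))).
  by rewrite eq_sym.
- right; case: (stP stlt w c) => [wc|wc|cw].
  + apply/blobP; split=> //; apply/negP => Uwc.
    apply: (no_fork w) => //; last by rewrite underlyingC.
    by rewrite underlyingC (arcU (arc_below bw wc bc)).
  + by move: ew nec; rewrite wc => ->.
  case/orP: (ew) => [h|we]; first by rewrite (arc_below lec cw h) in no_e_c.
  have wc' := arc_above lec cw we; exfalso.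
  case: (boolP (U w b)) => [wb|nwb].
    by apply: (no_fork w) => //; apply: arcU.
  apply: (no_square (arcU be) ew (arcU wc') (arcUr bc)) => //.
    by rewrite underlyingC.
  by rewrite (st_neq stlt bw).
Qed.

(** An arc from [x] to [c] would yield one to [e], so [x] would be in the blob and miss [c]; an arc
    from [c] to [x] would yield one from [c] to [e]. *)
Lemma blob_initial e x : e \in blob -> lt b x -> lt x e -> x \in blob.
Proof.
move=> eB bx xe; have [_ lec /nonadjP [ec ce]] := blobP _ eB.
apply/blobP; split=> //; first exact: st_trans lec.
apply/nonadjP; split; apply/negbTE/negP => h.
  case: (blob_nbr eB (arcUr (arc_below xe lec h))) => [xb|].
    by rewrite xb (st_irr stlt) in bx.
  by case/blobP => _ _ /nonadjP []; rewrite h.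
by rewrite (arc_above xe lec h) in ce.
Qed.

(** Such a neighbour would miss [a] and [c], making [b] the centre of an out-claw. *)
Lemma no_left_nbr w : lt w b -> ~~ U b w.
Proof.
move=> wb; apply/negP => bw.
have no_blob e : e \in blob -> ~~ U e w.
  move=> eB; apply/negP => /(blob_nbr eB) [wE|/blobP [bw' _ _]].
    by rewrite wE (st_irr stlt) in wb.
  by rewrite (st_asym stlt bw') in wb.
have := no_blob _ mem_blob => naw.
have bc' := st_trans stlt ba ac.
have ncw : ~~ U c w.
  apply/nonadjP; split; apply/negbTE/negP => h.
    by have := arcF bc; rewrite (arc_above wb bc' h).
  by move/negP: naw; apply; apply/arcUr/(arc_below (st_trans stlt wb ba) ac h).
case: (no_out_claw (blob_arc mem_blob) bc bw) => //.
- exact: (st_neq stlt ac).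
- by rewrite eq_sym (st_neq stlt (st_trans stlt wb ba)).
by rewrite eq_sym (st_neq stlt (st_trans stlt wb bc')).
Qed.

Lemma no_arc_into w : G w b = false.
Proof.
apply/negbTE/negP => wb; have bw := arcUr wb.
case: (stP stlt w b) => [h|h|h].
- by have := no_left_nbr h; rewrite bw.
- by have := arc_neq wb; rewrite h eqxx.
have bwF := arcF wb.
case: (stP stlt w c) => [wc|wc|cw].
- by rewrite (arc_below h wc bc) in bwF.
- by rewrite wc bc in bwF.
have aw := st_trans stlt ac cw.
have := blob_nbr mem_blob (arcUr (arc_above ba aw wb)).
case=> [wE|/blobP [_ wc _]]; first by rewrite wE (st_irr stlt) in h.
by rewrite (st_asym stlt wc) in cw.
Qed.

(** Reinserts [b] right after the blob and keeps the order of all other vertices. *)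
Definition move_past : rel V := fun x y =>
  if x == b then lt b y && (y \notin blob)
  else if y == b then lt x b || (x \in blob) else lt x y.

Lemma blob_lt x y : x \in blob -> lt b y -> y \notin blob -> lt x y.
Proof.
move=> xB lby yB; case: (stP stlt x y) => // [xy|yx].
  by rewrite -xy xB in yB.
by rewrite (blob_initial xB lby yx) in yB.
Qed.

Lemma lt_blob x y : x != b -> lt x y -> y \in blob -> lt x b || (x \in blob).
Proof.
move=> xb xy yB; case: (stP stlt x b) => [->//|/eqP|bx].
  by rewrite (negPf xb).
by rewrite (blob_initial yB bx xy) orbT.
Qed.

Lemma move_past_strict_total : strict_total move_past.
Proof.
rewrite /move_past; split=> [x|y x z|x y].
- by case: eqVneq => [->|_]; rewrite (st_irr stlt).
- have [xb|xb] := eqVneq x b; have [yb|yb] := eqVneq y b;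
    have [zb|zb] := eqVneq z b; rewrite ?xb ?yb ?zb ?(st_irr stlt) ?eqxx //.
  + move=> /andP [lby ynB] /orP []; rewrite ?(negPf ynB) //.
    by rewrite (st_asym stlt lby).
  + move=> /andP [lby ynB] yz; rewrite (st_trans stlt lby yz) /=.
    apply/negP => zB; have /orP [] := lt_blob yb yz zB; last exact/negP.
    by rewrite (st_asym stlt lby).
  + move=> /orP [xb'|xB] /andP [lbz znB]; first exact: st_trans lbz.
    exact: blob_lt.
  + move=> xy /orP [yb'|yB]; first by rewrite (st_trans stlt xy yb').
    exact: lt_blob yB.
  exact: st_trans.
move=> xy; have [xb|xb] := eqVneq x b; have [yb|yb] := eqVneq y b.
- by rewrite xb yb eqxx in xy.
- by rewrite (st_neqF stlt yb) -negb_or orNb.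
- by rewrite (st_neqF stlt xb) -negb_or orbN.
by case: (stP stlt x y) => [->|/eqP|->]; rewrite ?orbT // (negPf xy).
Qed.

(** It matters that [b] sends arcs to the whole blob and receives none, and that no edge joins the
    blob to a vertex beyond it. *)
Lemma move_past_catch : catch_order G move_past.
Proof.
have far e z : e \in blob -> U e z -> lt b z -> z \notin blob -> False.
  by move=> eB /(blob_nbr eB) [->|->]; rewrite ?(st_irr stlt).
move=> x y z; rewrite /move_past.
have [xb|xb] := eqVneq x b; have [yb|yb] := eqVneq y b;
  have [zb|zb] := eqVneq z b; rewrite ?xb ?yb ?zb ?(st_irr stlt) ?eqxx ?irrG //.
- move=> /andP [lby _] yz; split; first exact: arc_below yz.
  by rewrite no_arc_into.
- move=> /orP [xb'|xB] /andP [lbz znB]; first exact: catch.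
  split=> h; case: (far x z xB _ lbz znB);
    by first [exact: arcU | exact: arcUr].
- rewrite no_arc_into; move=> xy /orP [yb'|yB]; split=> // bx.
    exact: arc_above bx.
  exact: blob_arc.
exact: catch.
Qed.

End Violation.

(** The measure for the induction on moves. It is invariant under reversal, so moves in either
    direction can be mixed. *)
Definition same_side lt : {set V * V * V} := [set t : V * V * V |
  let: (u, v, w) := t in
  [&& G u v, G u w & lt u v && lt u w || lt v u && lt w u]].

Lemma move_past_same_side lt b a c : strict_total lt -> catch_order G lt ->
    lt b a -> lt a c -> G b c -> ~~ U a c ->
  #|same_side (move_past lt b c)| < #|same_side lt|.
Proof.
move=> st ca ba ac bc nac; apply: proper_card; rewrite properE.
apply/andP; split.
  (* No new triple appears: [b] receives no arc and had all its out-neighbours on its right. *)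
  apply/subsetP => -[[u v] w]; rewrite !inE /move_past /=.
  case/and3P=> uv uw; rewrite uv uw /=.
  have into := no_arc_into st ca ba ac bc nac.
  have vb : v != b by apply: contraTneq uv => ->; rewrite into.
  have wb : w != b by apply: contraTneq uw => ->; rewrite into.
  rewrite (negPf vb) (negPf wb); case: eqVneq => [ub|//]; rewrite ub.
  have nleft x : G u x -> lt b x.
    move=> ux; case: (stP st b x) => // [bx|xb].
      by move: (arc_neq ux); rewrite ub bx eqxx.
    by have := no_left_nbr st ca ba ac bc nac xb; rewrite -ub arcU.
  by rewrite !nleft.
(* This triple is lost: [a] is now left of [b], while [c] stays on its right. *)
apply/subsetPn; exists (b, a, c).
  by rewrite inE /= bc ba (st_trans st ba ac) (arc_below ca ba ac bc).
have aB := mem_blob ba ac nac.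
have lbc := st_trans st ba ac.
have cB : c \in blob lt b c = false.
  by apply/negP => /blobP [_]; rewrite (st_irr st).
rewrite inE /move_past eqxx aB andbF /=.
rewrite [c == b]eq_sym (negPf (st_neq st lbc)) cB.
by rewrite (st_asym st lbc) !andbF.
Qed.

Lemma same_side_converse lt : same_side (converse lt) = same_side lt.
Proof. by apply/setP => -[[u v] w]; rewrite !inE [X in _ && (_ && X)]orbC. Qed.

Lemma umbrella_exists lt :
    strict_total lt -> catch_order G lt ->
  exists2 lt', strict_total lt' & umbrella G lt'.
Proof.
have [n] := ubnP #|same_side lt|; elim: n lt => // n IHn lt le_n st ca.
pose bad (o : rel V) (t : V * V * V) :=
  [&& o t.1.1 t.1.2, o t.1.2 t.2, G t.1.1 t.2 & ~~ U t.1.2 t.2].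
(* To be used with [o] equal to [lt] or to its converse. *)
have step o : strict_total o -> catch_order G o -> same_side o = same_side lt ->
    forall t, bad o t -> exists2 lt', strict_total lt' & umbrella G lt'.
  move=> sto cao so [[b a] c] /and4P [/= ba ac bc nac].
  apply: (IHn (move_past o b c)).
  - rewrite ltnS -so in le_n; apply: leq_trans le_n.
    exact: move_past_same_side bc nac.
  - exact: move_past_strict_total bc.
  - exact: move_past_catch ba ac bc nac.
have [/existsP [t bt]|nb1] := boolP [exists t, bad lt t].
  exact: step bt.
have [/existsP [t bt]|nb2] := boolP [exists t, bad (converse lt) t].
  apply: step bt; first exact: converse_strict_total.
    exact: converse_catch_order.
  exact: same_side_converse.
exists lt => // x y z xy yz /orP [xz|zx].
  split; first by apply/arcU; apply: (arc_below ca) yz xz.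
  by move/existsPn/(_ (x, y, z)): nb1; rewrite /bad /= xy yz xz /= negbK.
split; last by apply/arcUr; apply: (arc_above ca) zx.
rewrite underlyingC; move/existsPn/(_ (z, y, x)): nb2.
by rewrite /bad /converse /= xy yz zx /= negbK.
Qed.


(** * Sorting true twins *)

Definition twin : rel V := fun u v =>
  [forall w, (u == w) || U u w == (v == w) || U v w].

Lemma twinP u v :
  reflect (forall w, (u == w) || U u w = (v == w) || U v w) (twin u v).
Proof. exact: 'forall_eqP. Qed.

Lemma twin_refl u : twin u u.
Proof. exact/twinP. Qed.

Lemma twinC u v : twin u v = twin v u.
Proof. by apply: eq_forallb => w; rewrite eq_sym. Qed.

Lemma twin_trans v u w : twin u v -> twin v w -> twin u w.
Proof. by move=> /twinP uv /twinP vw; apply/twinP => x; rewrite uv vw. Qed.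

Lemma twin_l u v w : twin u v -> twin u w = twin v w.
Proof.
by move=> uv; apply/idP/idP; apply: twin_trans; rewrite // twinC.
Qed.

Lemma twin_r u v w : twin u v -> twin w u = twin w v.
Proof. by move=> uv; rewrite !(twinC w); apply: twin_l. Qed.

Lemma twin_adj u v w : twin u v -> v != w -> U u w -> U v w.
Proof.
by move=> /twinP/(_ w) uv vw uw; move: uv; rewrite uw orbT (negPf vw).
Qed.

Lemma twinU u v : twin u v -> u != v -> U u v.
Proof. by move=> /twinP/(_ v) + uv; rewrite eqxx (negPf uv). Qed.

(** * True twins in an umbrella order *)

Section UmbrellaOrder.
Variable lt : rel V.
Hypotheses (stlt : strict_total lt) (umb : umbrella G lt).

Lemma umbrella_l x y z : lt x y -> lt y z -> U x z -> U x y.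
Proof. by move=> xy yz /(umb xy yz) []. Qed.

Lemma umbrella_r x y z : lt x y -> lt y z -> U x z -> U y z.
Proof. by move=> xy yz /(umb xy yz) []. Qed.

(** A neighbour [d] of [y] missed by [z] lies left of [x]; in the diamond on [x y] with ends [d] and
    [z], the middle [z] would have to be a source or a sink. A neighbour of [z] missed by [y] lies
    right of [z], misses [x] too, and is pendant at the middle. *)
Lemma misplaced_twins x y z : lt x y -> lt y z -> U x z ->
  G x z && G z y || G y z && G z x -> twin y z.
Proof.
move=> xy yz xz mid; have Uxy := umbrella_l xy yz xz.
have Uyz := umbrella_r xy yz xz; have lxz := st_trans stlt xy yz.
have nzy : z != y by rewrite eq_sym (st_neq stlt yz).
have nzx : z != x by rewrite eq_sym (st_neq stlt lxz).
have Uzy : U z y by rewrite underlyingC.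
have Uzx : U z x by rewrite underlyingC.
have no_pendant d : U z d -> ~~ U x d -> ~~ U y d -> d != x -> d != y -> False.
  move=> zd nxd nyd ndx ndy; case/orP: mid => /andP [h1 h2].
    exact: (no_mid_pendant h1 h2 Uxy zd nxd nyd).
  by apply: (no_mid_pendant h1 h2 _ zd nyd nxd); rewrite // underlyingC.
apply/twinP => d.
have [<-|yd] := eqVneq y d; first by rewrite Uzy orbT.
have [<-|zd] := eqVneq z d; first by rewrite Uyz.
apply/idP/idP => /= h.
  apply: contraT => nzd; case: (stP stlt d x) => [dx|dx|xd].
  - have ldy := st_trans stlt dx xy.
    have Udx : U d x by apply: umbrella_l dx xy _; rewrite underlyingC.
    have := diamond_ends (b := x) (c := y) (a := d) (d := z).
    rewrite Uxy Udx Uzx Uzy [U d y]underlyingC h underlyingC nzd eq_sym zd.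
    move=> /(_ isT isT isT isT isT isT isT).
    by case/orP: mid => /andP [h1 h2]; rewrite ?(arcF h1) ?(arcF h2) ?andbF.
  - by move: nzd; rewrite dx Uzx.
  case: (stP stlt d z) => [dz|dz|lzd].
  - by move: nzd; rewrite underlyingC (umbrella_r xd dz xz).
  - by rewrite dz eqxx in zd.
  by move: nzd; rewrite (umbrella_r yz lzd h).
apply: contraT => nyd; case: (stP stlt z d) => [lzd|zd'|dz].
- have [Uxd|nxd] := boolP (U x d).
    by move: nyd; rewrite (umbrella_r xy (st_trans stlt yz lzd)).
  case: (no_pendant d) => //; rewrite eq_sym // (st_neq stlt) //.
  exact: st_trans lzd.
- by rewrite zd' eqxx in zd.
case: (stP stlt d y) => [dy|dy|ly].
- have Udz : U d z by rewrite underlyingC.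
  by move: nyd; rewrite underlyingC (umbrella_l dy yz Udz).
- by rewrite dy eqxx in yd.
by move: nyd; rewrite (umbrella_l ly dz Uyz).
Qed.

(** Twin classes are thus consecutive and can be rearranged internally. *)
Lemma twin_between x y z : lt x y -> lt y z -> twin x z -> twin y x.
Proof.
move=> xy yz xz; have lxz := st_trans stlt xy yz.
have Uxz := twinU xz (st_neq stlt lxz).
have Uxy := umbrella_l xy yz Uxz; have Uyz := umbrella_r xy yz Uxz.
apply/twinP => d.
have [<-|yd] := eqVneq y d; first by rewrite Uxy orbT.
have [<-|xd] := eqVneq x d; first by rewrite underlyingC Uxy.
apply/idP/idP => /= h.
  case: (stP stlt d y) => [dy|dy|lyd].
  - case: (stP stlt d x) => [dx|dx|lxd].
    + by rewrite underlyingC; apply: umbrella_l dx xy _; rewrite underlyingC.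
    + by rewrite dx eqxx in xd.
    exact: umbrella_l lxd (st_trans stlt dy yz) Uxz.
  - by rewrite dy eqxx in yd.
  case: (stP stlt d z) => [dz|->//|lzd].
    exact: umbrella_l (st_trans stlt xy lyd) dz Uxz.
  have zd := umbrella_r yz lzd h.
  by apply: twin_adj zd; rewrite // twinC.
case: (stP stlt d y) => [dy|dy|lyd].
- case: (stP stlt d x) => [dx|dx|lxd].
  + have Uzd := twin_adj xz (_ : z != d) h.
    rewrite underlyingC; apply: umbrella_l dy yz _; rewrite underlyingC Uzd //.
    by rewrite eq_sym (st_neq stlt (st_trans stlt dx lxz)).
  + by rewrite dx eqxx in xd.
  by rewrite underlyingC; apply: umbrella_r lxd dy Uxy.
- by rewrite dy eqxx in yd.
exact: umbrella_r xy lyd h.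
Qed.

End UmbrellaOrder.

(** * Directions of arcs and the sorted order *)

Section SortTwins.
Variable lt : rel V.
Hypotheses (stlt : strict_total lt) (umb : umbrella G lt).

(** For adjacent vertices: the arc points to the right, whichever vertex is named first
    ([alignedC]). *)
Definition aligned u v := lt u v == G u v.

Lemma arc_total u v : U u v -> G v u = ~~ G u v.
Proof. by case/orP => h; rewrite h (arcF h). Qed.

Lemma alignedC u v : U u v -> aligned u v = aligned v u.
Proof.
move=> uv; rewrite /aligned (st_neqF stlt (underlying_neq uv)) (arc_total uv).
by case: (lt u v); case: (G u v).
Qed.

(** The outcomes correspond to the middle of the transitive triangle being [y], [z] or [x]; the last
    uses [misplaced_twins] in the converse order. *)
Lemma triangle_aligned x y z : lt x y -> lt y z -> U x z ->
  [\/ G x y = G x z /\ G y z = G x z, twin y z /\ G x y = G x z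
    | twin x y /\ G y z = G x z].
Proof.
move=> xy yz xz; have [Uxy Uyz] := umb xy yz xz.
have zmid := misplaced_twins stlt umb xy yz xz.
have xmid : G z x && G x y || G y x && G x z -> twin x y.
  rewrite twinC; apply: (misplaced_twins (converse_strict_total stlt)
    (converse_umbrella umb)) => //.
  by rewrite underlyingC.
move: zmid xmid; rewrite (arc_total Uxy) (arc_total Uyz) (arc_total xz).
have := @acyc x y z; have := @acyc x z y.
rewrite (arc_total Uxy) (arc_total Uyz) (arc_total xz).
case: (G x y); case: (G y z); case: (G x z) => //= h2 h1 h3 h4;
  try by constructor 1.
- by have := h1 isT isT.
- by constructor 2; split=> //; apply: h3.
- by constructor 3; split=> //; apply: h4.
- by constructor 3; split=> //; apply: h4.
- by constructor 2; split=> //; apply: h3.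
by have := h2 isT isT.
Qed.

(** By consecutiveness [w] is not between [u] and [v], so [triangle_aligned] applies with [w] at an
    extreme. *)
Lemma aligned_twin u v w : twin u v -> U w u -> ~~ twin w u ->
  aligned w u = aligned w v.
Proof.
have main u' v' : lt u' v' -> twin u' v' -> U w u' -> ~~ twin w u' ->
    aligned w u' = aligned w v'.
  move=> {u v} uv tuv wu nwu.
  have nwv : ~~ twin w v' by rewrite -(twin_r _ tuv).
  have nvw : v' != w by apply: contraNneq nwv => ->; apply: twin_refl.
  have wv : U w v'.
    by rewrite underlyingC; apply: (twin_adj tuv nvw); rewrite underlyingC.
  case: (stP stlt w u') => [lwu|wu'|luw].
  - rewrite /aligned lwu (st_trans stlt lwu uv).
    case: (triangle_aligned lwu uv wv) => [[-> _]|[_ ->]|[twu]] //.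
    by rewrite twu in nwu.
  - by rewrite wu' twin_refl in nwu.
  case: (stP stlt w v') => [lwv|wv'|lvw].
  - by rewrite (twin_between stlt umb luw lwv tuv) in nwu.
  - by rewrite wv' twin_refl in nwv.
  have [uw vw] : U u' w /\ U v' w by split; rewrite underlyingC.
  rewrite -!(alignedC uw) -(alignedC vw) /aligned luw lvw.
  case: (triangle_aligned uv lvw uw) => [[_ ->]|[tvw]|[_ ->]] //.
  by rewrite twinC tvw in nwv.
move=> tuv wu nwu; case: (stP stlt u v) => [luv|->//|lvu]; first exact: main.
have nwv : ~~ twin w v by rewrite -(twin_r _ tuv).
have nvw : v != w by apply: contraNneq nwv => ->; apply: twin_refl.
symmetry; apply: main => //; first by rewrite twinC.
by rewrite underlyingC; apply: twin_adj tuv nvw _; rewrite underlyingC.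
Qed.

Lemma aligned_triangle x y z : U x y -> U x z -> U y z ->
  ~~ twin x y -> ~~ twin x z -> ~~ twin y z -> aligned x z = aligned y z.
Proof.
have main x' y' : lt x' y' -> U x' y' -> U x' z -> U y' z ->
    ~~ twin x' y' -> ~~ twin x' z -> ~~ twin y' z ->
    aligned x' z = aligned y' z.
  move=> {x y} lxy xy xz yz nxy nxz nyz.
  have sorted a b c : lt a b -> lt b c -> U a c -> ~~ twin a b -> ~~ twin b c ->
      G a b = G a c /\ G b c = G a c.
    move=> ab bc ac nab nbc; case: (triangle_aligned ab bc ac) => // -[h].
      by rewrite h in nbc.
    by rewrite h in nab.
  case: (stP stlt x' z) => [lxz|xz'|lzx].
  - case: (stP stlt y' z) => [lyz|yz'|lzy].
    + rewrite /aligned lxz lyz.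
      by have [_ ->] := sorted _ _ _ lxy lyz xz nxy nyz.
    + by rewrite yz' twin_refl in nyz.
    rewrite (alignedC yz) /aligned lxz lzy; rewrite twinC in nyz.
    by have [-> ->] := sorted _ _ _ lxz lzy xy nxz nyz.
  - by rewrite xz' twin_refl in nxz.
  rewrite (alignedC xz) (alignedC yz) /aligned lzx (st_trans stlt lzx lxy).
  rewrite twinC in nxz; rewrite underlyingC in yz.
  by have [-> _] := sorted _ _ _ lzx lxy yz nxz nxy.
move=> xy xz yz nxy nxz nyz; case: (stP stlt x y) => [lxy|->//|lyx].
  exact: main.
by symmetry; apply: main => //; [rewrite underlyingC | rewrite twinC].
Qed.

(** If [w] and [w'] are neither twins nor adjacent, they end a diamond on [u v]: one is a source and
    the other a sink, and the umbrella property puts them on opposite sides of [u]. *)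
Lemma aligned_outer u v w w' : twin u v -> u != v -> U w u -> U w' u ->
  ~~ twin w u -> ~~ twin w' u -> aligned w u = aligned w' u.
Proof.
move=> tuv nuv wu wu' nwu nwu'.
have [uw uw'] : U u w /\ U u w' by split; rewrite underlyingC.
have [tw|ntw] := boolP (twin w w').
  rewrite !(alignedC wu) (alignedC wu').
  by apply: aligned_twin; rewrite // twinC.
have [ww|nww] := boolP (U w w'); first exact: aligned_triangle.
have nbr x : U u x -> ~~ twin x u -> U x v.
  move=> ux nxu; rewrite underlyingC; apply: (twin_adj tuv _ ux).
  by apply: contraNneq nxu => <-; rewrite twinC.
have neww : w != w' by apply: contraNneq ntw => ->; apply: twin_refl.
have := diamond_ends (twinU tuv nuv) wu (nbr _ uw nwu)
                     wu' (nbr _ uw' nwu') nww neww.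
have nww' : ~~ U w' w by rewrite underlyingC.
have arcs : G w u = ~~ G w' u -> lt w u = ~~ lt w' u ->
    aligned w u = aligned w' u.
  by rewrite /aligned => -> ->; case: (G w' u); case: (lt w' u).
have lts : lt w u = ~~ lt w' u.
  case: (stP stlt w u) => [lwu|h|luw]; last 1 first.
  - rewrite (st_asym stlt luw); symmetry; apply/negbF.
    case: (stP stlt w' u) => [//|h|luw'].
      by move: nwu'; rewrite h twin_refl.
    case: (stP stlt w w') => [l|h|l]; last 1 first.
    + by move: nww'; rewrite (umbrella_r umb luw' l uw).
    + by move: nww; rewrite (umbrella_r umb luw l uw').
    by move: neww; rewrite h eqxx.
  - rewrite lwu; symmetry; apply/negP => nlt.
    case: (stP stlt w w') => [l|h|l].
    + by move: nww; rewrite (umbrella_l umb l nlt wu).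
    + by move: neww; rewrite h eqxx.
    by move: nww'; rewrite (umbrella_l umb l lwu wu').
  by move: nwu; rewrite h twin_refl.
by case/orP => /and4P [h1 h2 h3 h4]; apply: arcs => //; rewrite ?h1 (arcF h3).
Qed.

(* [fwd u] tells whether the arcs between the twin class of [u] and the other
   vertices go from left to right; by [aligned_outer] they all agree as soon as
   the class has two elements. *)
Definition fwd u := [exists w, [&& U w u, ~~ twin w u & aligned w u]].

Lemma fwd_aligned u v w : twin u v -> u != v -> U w u -> ~~ twin w u ->
  fwd u = aligned w u.
Proof.
move=> tuv nuv wu nwu; apply/existsP/idP => [[w' /and3P [wu' nwu']]|h].
  by rewrite (aligned_outer tuv nuv wu' wu).
by exists w; rewrite wu nwu.
Qed.

Lemma fwd_twin u v : twin u v -> fwd u = fwd v.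
Proof.
have main u' v' : twin u' v' -> fwd u' -> fwd v'.
  move=> tuv /existsP [w /and3P [wu nwu al]]; apply/existsP; exists w.
  have nwv : ~~ twin w v' by rewrite -(twin_r _ tuv).
  rewrite nwv -(aligned_twin tuv) // al !andbT underlyingC.
  apply: (twin_adj tuv); last by rewrite underlyingC.
  by apply: contraNneq nwv => ->; apply: twin_refl.
by move=> tuv; apply/idP/idP; apply: main; rewrite // twinC.
Qed.

(** A class without outside neighbours has [fwd] false, so its arcs run right to left; either
    direction would do there. *)
Definition sort_twins : rel V := fun u v =>
  if twin u v then (u != v) && (fwd u == G u v) else lt u v.

Lemma twin_gap x y z : twin x y -> ~~ twin y z -> lt x z = lt y z.
Proof.
have main x' y' : lt x' y' -> twin x' y' -> ~~ twin y' z -> lt x' z = lt y' z.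
  move=> {x y} xy txy nyz; case: (stP stlt y' z) => [yz|yz|zy].
  - by rewrite yz (st_trans stlt xy yz).
  - by rewrite yz twin_refl in nyz.
  rewrite (st_asym stlt zy); apply/negP => xz.
  have := twin_between stlt umb xz zy txy.
  by rewrite (twin_r _ txy) twinC (negPf nyz).
move=> txy nyz; case: (stP stlt x y) => [xy|->//|yx]; first exact: main.
by symmetry; apply: main => //; [rewrite twinC | rewrite (twin_l _ txy)].
Qed.

Lemma twin_gap_r x y z : twin x y -> ~~ twin y z -> lt z x = lt z y.
Proof.
move=> txy nyz; have nxz : ~~ twin x z by rewrite (twin_l _ txy).
have neq w : ~~ twin w z -> w != z by apply: contraNneq => ->; apply: twin_refl.
by rewrite !(st_neqF stlt (neq _ _)) // (twin_gap txy).
Qed.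

Lemma twin_arcs x y z : twin x y -> twin y z -> G x y -> G y z -> G x z.
Proof.
move=> xy yz Gxy Gyz; have xz := twin_trans xy yz.
have nxz : x != z.
  by apply: contraTneq Gyz => <-; rewrite (arcF Gxy).
by case/orP: (twinU xz nxz) => //; rewrite (acyc Gxy Gyz).
Qed.

Lemma sort_twins_strict_total : strict_total sort_twins.
Proof.
rewrite /sort_twins; split=> [x|y x z|x y nxy]; first by rewrite twin_refl eqxx.
  have [txy|nxy] := boolP (twin x y); have [tyz|nyz] := boolP (twin y z).
  - rewrite (twin_trans txy tyz) -(fwd_twin txy).
    move=> /andP [exy /eqP fxy] /andP [eyz /eqP fyz].
    have [Uxy Uyz] := (twinU txy exy, twinU tyz eyz).
    case fx: (fwd x) fxy fyz => /esym Gxy /esym Gyz.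
      have Gxz := twin_arcs txy tyz Gxy Gyz.
      by rewrite Gxz (arc_neq Gxz).
    rewrite twinC in txy; rewrite twinC in tyz.
    have Gzx : G z x.
      by apply: (twin_arcs tyz txy); rewrite arc_total ?Gxy ?Gyz.
    by rewrite (arcF Gzx) eq_sym (arc_neq Gzx).
  - by rewrite (twin_l _ txy) (negPf nyz) -(twin_gap txy nyz).
  - rewrite -(twin_r _ tyz) (negPf nxy) => xy _.
    by rewrite -(twin_gap_r tyz) // twinC -(twin_r _ tyz).
  move=> xy yz; have [txz|nxz] := boolP (twin x z); last exact: st_trans yz.
  by have := twin_between stlt umb xy yz txz; rewrite twinC (negPf nxy).
rewrite (twinC y); have [txy|ntxy] := boolP (twin x y).
  rewrite nxy [y == x]eq_sym nxy -(fwd_twin txy) (arc_total (twinU txy nxy)).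
  by case: (fwd x); case: (G x y).
by rewrite (st_neqF stlt nxy) orbN.
Qed.

Lemma sort_twins_coherent : coherent G sort_twins.
Proof.
have inner x y : sort_twins x y -> twin x y -> G x y = fwd x.
  by rewrite /sort_twins => + txy; rewrite txy => /andP [_ /eqP->].
have outer u v w : twin u v -> u != v -> lt u w -> U u w -> ~~ twin u w ->
    fwd u = G u w.
  move=> tuv nuv uw Uuw nuw; rewrite (fwd_aligned (w := w) tuv nuv).
  - by rewrite -(alignedC Uuw) /aligned uw.
  - by rewrite underlyingC.
  by rewrite twinC.
have outer' u v w : twin u v -> u != v -> lt w u -> U w u -> ~~ twin w u ->
    fwd u = G w u.
  move=> tuv nuv wu Uwu nwu; rewrite (fwd_aligned (w := w) tuv nuv) //.
  by rewrite /aligned wu.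
(* Coherence amounts to the three arcs all pointing the same way. *)
suff main x y z : sort_twins x y -> sort_twins y z -> U x z ->
    [/\ G x y = G x z, G y z = G x z, G y x = G z x & G z y = G z x].
  move=> x y z xy yz; split=> h.
    by have [-> -> _ _] := main x y z xy yz (arcU h).
  by have [_ _ -> ->] := main x y z xy yz (arcUr h).
move=> xy yz Uxz.
have nxy := st_neq sort_twins_strict_total xy.
have nyz := st_neq sort_twins_strict_total yz.
have xz := st_trans sort_twins_strict_total xy yz.
suff [Uxy Uyz [e1 e2]] : [/\ U x y, U y z & G x y = G x z /\ G y z = G x z].
  by rewrite (arc_total Uxy) (arc_total Uyz) (arc_total Uxz) e1 e2.
(* Arcs inside a class follow [fwd] by [inner], those leaving a class of several vertices by [outer]
   and [outer']; without twins [triangle_aligned] has one outcome left. *)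
have [txz|nxz] := boolP (twin x z).
  have txy : twin x y.
    apply: contraT => ntxy.
    have ntyz : ~~ twin y z by rewrite -(twin_r _ txz) twinC.
    move: xy yz; rewrite /sort_twins (negPf ntxy) (negPf ntyz) => lxy lyz.
    by rewrite twinC (twin_between stlt umb lxy lyz txz) in ntxy.
  have tyz : twin y z by rewrite -(twin_l _ txy).
  split; [exact: twinU|exact: twinU|].
  by rewrite (inner _ _ xy) ?(inner _ _ yz) ?(inner _ _ xz) ?(fwd_twin txy).
have lxz : lt x z by move: xz; rewrite /sort_twins (negPf nxz).
have [txy|ntxy] := boolP (twin x y).
  have ntyz : ~~ twin y z by rewrite -(twin_l _ txy).
  have lyz : lt y z by move: yz; rewrite /sort_twins (negPf ntyz).
  have Uyz : U y z by exact: (twin_adj txy nyz Uxz).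
  have nyx : y != x by rewrite eq_sym.
  have tyx : twin y x by rewrite twinC.
  split; [exact: twinU| by []|].
  rewrite (inner _ _ xy txy).
  by rewrite -(outer y x z) // -(outer x y z) // (fwd_twin txy).
have lxy : lt x y by move: xy; rewrite /sort_twins (negPf ntxy).
have [tyz|ntyz] := boolP (twin y z).
  have Uxy : U x y.
    rewrite underlyingC; apply: (twin_adj (u := z)) => //; last 1 first.
    - by rewrite underlyingC.
    - by rewrite twinC.
    by rewrite eq_sym.
  have nzy : z != y by rewrite eq_sym.
  have tzy : twin z y by rewrite twinC.
  split; [by []|exact: twinU|].
  rewrite (inner _ _ yz tyz).
  by rewrite -(outer' y z x) // -(outer' z y x) // (fwd_twin tyz).
have lyz : lt y z by move: yz; rewrite /sort_twins (negPf ntyz).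
have [Uxy Uyz] := umb lxy lyz Uxz; split=> //.
case: (triangle_aligned lxy lyz Uxz) => // -[h]; first by rewrite h in ntyz.
by rewrite h in ntxy.
Qed.

End SortTwins.

End ForbiddenFree.

(** * The characterization *)

(** The arc between the two extreme vertices forces an arc from its tail to the vertex in between,
    against the cycle. *)
Lemma catch_order_acyclic (V : finType) (G lt : rel V) :
    oriented G -> irreflexive G -> strict_total lt -> catch_order G lt ->
  forall x y z, G x y -> G y z -> G z x = false.
Proof.
move=> orG irrG st ca x y z xy yz; apply/negbTE/negP => zx.
have up a b c : lt a b -> lt b c -> G b c -> G c a -> False.
  by move=> ab bc Gbc /(proj2 (ca _ _ _ ab bc)); rewrite (arcF orG Gbc).
have down a b c : lt a b -> lt b c -> G b a -> G a c -> False.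
  by move=> ab bc Gba /(proj1 (ca _ _ _ ab bc)); rewrite (arcF orG Gba).
have neq a b : G a b -> lt a b \/ lt b a.
  move=> ab; case: (stP st a b) => [|e|]; [by left| |by right].
  by move: ab; rewrite e irrG.
case: (neq _ _ xy) => lxy; case: (neq _ _ yz) => lyz; case: (neq _ _ zx) => lzx.
- exact: up lxy lyz yz zx.
- exact: up lxy lyz yz zx.
- exact: up lzx lxy xy yz.
- exact: down lzx lyz zx xy.
- exact: up lyz lzx zx xy.
- exact: down lxy lzx xy yz.
- exact: down lyz lxy yz zx.
exact: down lyz lxy yz zx.
Qed.

Definition coherent_triple (H : rel nat) (x y z : nat) : bool :=
  (H x z ==> H x y && H y z) && (H z x ==> H z y && H y x).

(** Evaluates all 24 orders of the four vertices; the listed triples are the increasing triples of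
    positions. *)
Lemma forbidden_incoherent :
  all (fun D => all (fun s =>
    has (fun t : nat * nat * nat => ~~ coherent_triple
           [rel i j | (i.+1, j.+1) \in D]
           (nth 0 s t.1.1) (nth 0 s t.1.2) (nth 0 s t.2))
        [:: (0, 1, 2); (0, 1, 3); (0, 2, 3); (1, 2, 3)])
    (permutations (iota 0 4))) forbidden.
Proof. by vm_compute. Qed.

Lemma coherent_forbidden_free (V : finType) (G lt : rel V) D :
    strict_total lt -> coherent G lt -> D \in forbidden ->
  ~ contains_induced (digraph4 D) G.
Proof.
move=> st coh DF [f [fI fE]].
pose le : rel 'I_4 := [rel i j | (i == j) || lt (f i) (f j)].
(* The order that [lt] induces on the copy of [D] is one of the 24 checked. *)
pose s := sort le (enum 'I_4).
have le_total : total le.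
  move=> i j; rewrite /le /=.
  by case: (stP st (f i) (f j)) => [h|/fI->|h]; rewrite ?h ?eqxx ?orbT /= ?orbT.
have le_trans : transitive le.
  move=> j i k; rewrite /le /= => /predU1P [->//|ij] /predU1P [<-|jk].
    by rewrite ij orbT.
  by rewrite (st_trans st ij jk) orbT.
have le_refl : reflexive le by move=> i; rewrite /le /= eqxx.
have sz : size s = 4 by rewrite size_sort size_enum_ord.
have us : uniq s by rewrite sort_uniq enum_uniq.
have lts i j : i < j -> j < 4 -> lt (f (nth ord0 s i)) (f (nth ord0 s j)).
  move=> ij j4; have i4 := ltn_trans ij j4.
  have := sorted_leq_nth le_trans le_refl ord0 (sort_sorted le_total _).
  move=> /(_ (enum 'I_4) i j); rewrite -/s !inE sz.
  move=> /(_ i4 j4 (ltnW ij)) /orP [|//].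
  by rewrite nth_uniq ?sz // ltn_eqF.
have ps : map val s \in permutations (iota 0 4).
  by rewrite mem_permutations -val_enum_ord perm_map // perm_sort.
have /allP/(_ D DF)/allP/(_ _ ps)/hasP [t tin /negP[]] := forbidden_incoherent.
have {tin} [l1 [l2 l3]] : t.1.1 < t.1.2 /\ t.1.2 < t.2 /\ t.2 < 4.
  by move: tin; rewrite !inE => /or4P [] /eqP->.
have l2' := ltn_trans l2 l3; have l1' := ltn_trans l1 l2'.
rewrite !(nth_map ord0) ?sz // /coherent_triple /=.
have [h1 h2] := coh _ _ _ (lts _ _ l1 l2') (lts _ _ l2 l3).
by move: h1 h2; rewrite !fE /digraph4 /= => h1 h2;
   apply/andP; split; apply/implyP; [case/h1=> -> -> | case/h2=> -> ->].
Qed.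

Theorem theorem7p6 (R : realType) (V : finType) (G : rel V)
    (irrG : irreflexive G) (icdG : is_oriented_ICD R G)
    (chG : chordal (underlying G)) :
  is_proper_oriented_ICD R G <->
  (forall D : seq (nat * nat), D \in forbidden ->
     ~ contains_induced (digraph4 D) G).
Proof.
split=> [/proper_oriented_ICD_coherent [lt st coh] D DF|free].
  exact: coherent_forbidden_free st coh DF.
have orG := icdG.2; have [lt0 st0 ca0] := oriented_ICD_catch_order icdG.
have acyc := catch_order_acyclic orG irrG st0 ca0.
have [lt st umb] := umbrella_exists irrG orG free acyc chG st0 ca0.
apply: (coherent_proper_oriented_ICD R irrG orG (lt := sort_twins G lt)).
  exact: (sort_twins_strict_total irrG orG free acyc st umb).
exact: (sort_twins_coherent irrG orG free acyc st umb).
Qed.
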